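(* There is a constant $C>0$ such that every circular-arc graph $G$ on $n$ vertices satisfies $\mathrm{sd}(G)\le C\sqrt{n}$.
   Context: A circular-arc graph is the intersection graph of a finite family of arcs of a circle (vertices are the arcs, two adjacent iff the arcs intersect). For a graph $G$ and distinct vertices $u,v$, $\mathrm{sd}_G(u,v)$ is the number of vertices other than $u,v$ that are adjacent to exactly one of $u$ and $v$. The symmetric difference of $G$ is $\mathrm{sd}(G)=\max_H \min_{u\ne v\in V(H)} \mathrm{sd}_H(u,v)$, the maximum taken over all induced subgraphs $H$ of $G$ with at least two vertices. *)

(* Defs.v *)
(* MathComp / MathComp-Analysis *)
From mathcomp Require Import all_boot all_order all_algebra.
From mathcomp Require Import boolp classical_sets set_interval reals trigo.

Set Implicit Arguments.
Unset Strict Implicit.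
Unset Printing Implicit Defensive.

Import Order.TTheory GRing.Theory Num.Theory.

Local Open Scope classical_set_scope.
Local Open Scope ring_scope.

(* A finite simple graph is a finType of vertices together with a symmetric,
   irreflexive adjacency relation. *)

Definition circle_point (R : realType) (t : R) : R * R := (cos t, sin t).

(* Arcs of the unit circle.  The interval [i] may be open, closed or half-open,
   and its length is not bounded, so single points and the whole circle are
   arcs; the empty set is not. *)
Definition is_arc (R : realType) (A : set (R * R)) : Prop :=
  exists2 i : interval R,
    [set` i] !=set0 & A = @circle_point R @` [set` i].

(* [A] is an indexed family: distinct vertices may carry the same arc. *)
Definition circular_arc_graph (R : realType) (T : finType) (e : rel T) : Prop :=
  exists2 A : T -> set (R * R),
    forall v, is_arc (A v) &
    forall u v, u != v -> (e u v <-> A u `&` A v !=set0).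

Definition sd_pair (T : finType) (e : rel T) (u v : T) : nat :=
  #|[pred w | [&& w != u, w != v & e w u (+) e w v]]|.

(* The starting value #|T| is an upper bound of every [sd_pair e u v], so it
   does not affect the minimum as soon as T has two distinct elements. *)
Definition min_sd (T : finType) (e : rel T) : nat :=
  \big[Order.min/#|T|]_(p : T * T | p.1 != p.2) sd_pair e p.1 p.2.

Definition induced (T : finType) (e : rel T) (S : {set T}) :
  rel {x : T | x \in S} := fun x y => e (val x) (val y).
Arguments induced {T} e S _ _.

(* The maximum over the empty range, i.e. when #|T| <= 1, is 0. *)
Definition sd (T : finType) (e : rel T) : nat :=
  (\max_(S : {set T} | 1 < #|S|) min_sd (induced e S))%N.

(* Main.v *)
(* Cut the circle at angle 0, so that an arc is a subset of [0, 2pi[ that is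
   either convex, or contains 0 and has a convex complement.  Such a set is
   respectively the intersection or the union of an up-set U and a down-set V.
   Put a w u when U_w meets V_u.  For distinct w and u, adjacency is
   "a w u and a u w" if both sets are convex, "a w u or a u w" if exactly one
   is, and automatic otherwise.  The rows of a are nested, and so are its
   columns.  So if u and v are of the same kind, with row sums in a common block
   of length s and column sums in a common block of length s, then fewer than
   2s vertices tell u from v.  There are about 2(n/s)^2 classes, so the
   pigeonhole principle gives such a pair with s = O(sqrt n).  Induced subgraphs
   are again circular-arc graphs. *)
Require Import Defs.
From mathcomp Require Import all_boot all_order all_algebra.
From mathcomp Require Import boolp classical_sets set_interval reals trigo.
From mathcomp Require Import num_normedtype zify lra.

Set Implicit Arguments.
Unset Strict Implicit.
Unset Printing Implicit Defensive.

Import Order.TTheory GRing.Theory Num.Theory.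

Local Open Scope ring_scope.

(** * Counting: a pair with small symmetric difference from nested rows and columns *)

Lemma card_symdiff_nested (T : finType) (P Q : pred T) :
  {subset P <= Q} \/ {subset Q <= P} ->
  #|[pred w | P w (+) Q w]| = ((#|P| - #|Q|) + (#|Q| - #|P|))%N.
Proof.
wlog PQ : P Q / {subset P <= Q}.
  move=> H [PQ|QP]; first by apply: H => //; left.
  rewrite addnC -H //; last by left.
  by apply: eq_card => w; rewrite !inE addbC.
move=> _; have -> : #|[pred w | P w (+) Q w]| = #|[predD Q & P]|.
  apply: eq_card => w; rewrite !inE.
  by have := PQ w; rewrite /in_mem /=; case: (P w) => // ->.
have := cardID P Q; have -> : #|[predI Q & P]| = #|P|.
  apply: eq_card => w; rewrite !inE andbC.
  by have := PQ w; rewrite /in_mem /=; case: (P w) => // ->.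
have := subset_leq_card (introT fintype.subsetP PQ); lia.
Qed.

Lemma same_block_dist (s m n : nat) :
  (0 < s -> m %/ s = n %/ s -> (m - n) + (n - m) < s)%N.
Proof.
move=> s0 E; have := ltn_pmod m s0; have := ltn_pmod n s0.
by have := divn_eq m s; have := divn_eq n s; rewrite E; lia.
Qed.

Lemma sd_pair_pigeonhole (T : finType) (e a : rel T) (t : T -> bool) (s : nat) :
  (forall u v w, t u = t v -> w != u -> w != v ->
     a w u = a w v -> a u w = a v w -> e w u = e w v) ->
  (forall u v, {subset a u <= a v} \/ {subset a v <= a u}) ->
  (forall u v, {subset a^~ u <= a^~ v} \/ {subset a^~ v <= a^~ u}) ->
  (0 < s -> 2 * (#|T| %/ s).+1 ^ 2 < #|T| ->
   exists u v, u != v /\ sd_pair e u v <= 2 * s)%N.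
Proof.
move=> He Hr Hc s0 HT; set d := (#|T| %/ s).+1.
(* Sums range over 0, ..., #|T| inclusive, hence the successor in [d]; there are then 2 d^2 classes
   in all. *)
have block (P : pred T) : (#|P| %/ s < d)%N by rewrite ltnS leq_div2r ?max_card.
pose f u : bool * ('I_d * 'I_d) :=
  (t u, (Ordinal (block (a u)), Ordinal (block (a^~ u)))).
have /injectivePn [u [v uv [Et Er Ec]]] : ~~ injectiveb f.
  apply/negP => /injectiveP /leq_card; rewrite !card_prod card_bool !card_ord.
  by move: HT; rewrite -/d expnS expn1 ltnNge => /negP.
exists u, v; split => //.
have leC : (sd_pair e u v <= #|[pred w | a^~ u w (+) a^~ v w]|
                             + #|[pred w | a u w (+) a v w]|)%N.
  rewrite -cardUI; apply: leq_trans (leq_addr _ _).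
  apply: subset_leq_card; apply/fintype.subsetP => w; rewrite !inE => /and3P [wu wv ne].
  apply: contraT; rewrite negb_or !negb_add => /andP [/eqP E1 /eqP E2].
  by move: ne; rewrite (He u v w) // addbb.
(* By nestedness each count is the distance between two row sums or two column sums, and a shared
   block keeps it below [s]. *)
apply: leq_trans leC _; rewrite !card_symdiff_nested //.
have := same_block_dist s0 Er; have := same_block_dist s0 Ec.
rewrite /=; lia.
Qed.

Lemma nat_sqrt_bounds (m : nat) : exists k, (k ^ 2 <= m < k.+1 ^ 2)%N.
Proof.
elim: m => [|m [k /andP [H1 H2]]]; first by exists 0%N.
case: (ltnP m.+1 (k.+1 ^ 2)) => H; first by exists k; rewrite H; lia.
by exists k.+1; rewrite H; nia.
Qed.

Lemma sd_pair_sqrt (T : finType) (e a : rel T) (t : T -> bool) :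
  (forall u v w, t u = t v -> w != u -> w != v ->
     a w u = a w v -> a u w = a v w -> e w u = e w v) ->
  (forall u v, {subset a u <= a v} \/ {subset a v <= a u}) ->
  (forall u v, {subset a^~ u <= a^~ v} \/ {subset a^~ v <= a^~ u}) ->
  (1 < #|T| ->
   exists u v k, [/\ u != v, k ^ 2 <= #|T| & sd_pair e u v <= 16 * k])%N.
Proof.
move=> He Hr Hc T1; have [k /andP [k1 k2]] := nat_sqrt_bounds #|T|.
(* For small k any pair will do, since #|T| <= (k+1)^2 - 1 = k(k+2) <= 16k. *)
case: (ltnP k 3) => k3.
  case/card_gt1P: T1 => u [v [_ _ uv]]; exists u, v, k; split=> //.
  apply: leq_trans (max_card _) _; nia.
(* For s = 4(k+1), #|T| < (k+1)^2 gives 4d <= k with d = #|T| %/ s. So 2(d+1)^2 <= (k+4)^2/8 < k^2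
   once k >= 3, and 2s = 8(k+1) <= 16k. *)
have [||u [v [uv H]]] := @sd_pair_pigeonhole T e a t (4 * k.+1) He Hr Hc.
- by [].
- set d := (_ %/ _)%N.
  have dm : (d * (4 * k.+1) <= #|T|)%N by apply: leq_divM.
  have dk : (4 * d < k.+1)%N.
    by rewrite -(ltn_pmul2r (ltn0Sn k)); apply: leq_ltn_trans k2; lia.
  apply: leq_trans k1; nia.
exists u, v, k; split=> //; lia.
Qed.

(** * Arcs as sets of angles in [0, 2pi[ *)

Section Circle.
Variable R : realType.
Implicit Types (t x y : R) (A : set (R * R)).
Local Notation circle := (@circle_point R).
Local Notation tau := (pi *+ 2 : R).

Let angles : set R := [set x | 0 <= x < tau]%classic.

Lemma tau_gt0 : 0 < tau.
Proof. by rewrite mulrn_wgt0 ?pi_gt0. Qed.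

Lemma circle_pointDn t (n : nat) : circle (t + tau *+ n) = circle t.
Proof.
by rewrite /circle_point !periodicn //; [exact: sinD2pi | exact: cosD2pi].
Qed.

Lemma circle_pointDz t (k : int) : circle (t + tau *~ k) = circle t.
Proof.
case: k => n; first exact: circle_pointDn.
by rewrite -(circle_pointDn _ n.+1) NegzE mulrNz pmulrn subrK.
Qed.

Lemma circle_point_inj : {in angles &, injective circle}.
Proof.
move=> x y; rewrite !inE.
wlog yx : x y / y <= x.
  by case: (leP y x) => [yx H|/ltW xy H] Dx Dy E; [|symmetry]; apply: H.
move=> /andP [x0 x1] /andP [y0 y1] [Ec Es].
apply/eqP; rewrite -subr_eq0; apply: contraT => ne.
have : cos (x - y) = 1.
  by rewrite cosB Ec Es -!expr2 cos2Dsin2.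
have -> : x - y = ((x - y) / 2) *+ 2 by lra.
(* Half the difference lies in ]0, pi[, so its sine s is positive, whereas cos(x - y) = 1 - 2s^2 = 1
   would force s = 0. *)
have : 0 < sin ((x - y) / 2).
  apply: sin_gt0_pi; move: x1; rewrite -mulr_natr => x1.
  by have : 0 < x - y; [rewrite lt_def ne subr_ge0 | lra].
move: (cos2Dsin2 ((x - y) / 2)); rewrite cos_mulr2n.
move: (cos _) (sin _) => c s c2s2 s0 c2; suff: 0 < s ^+ 2 by lra.
exact: exprn_gt0.
Qed.

Lemma circle_point_angle t : exists k : int, angles (t + tau *~ k).
Proof.
exists (- Num.floor (t / tau)); rewrite /angles /= mulrNz.
have := floor_itv (t / tau); rewrite ler_pdivlMr ?tau_gt0 // ltr_pdivrMr ?tau_gt0 //.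
rewrite intrD mulrDl mul1r !mulrzl; lra.
Qed.

(** An angle is covered when one of its translates by a multiple of [tau] falls in the interval [i].
    The two cases are whether or not [i] itself contains a multiple of [tau], that is, whether the
    arc passes through the cut. *)
Lemma arc_angles A : is_arc A ->
  (angles `&` circle @^-1` A !=set0)%classic /\
  (is_interval (angles `&` circle @^-1` A)%classic \/
   A (circle 0) /\ is_interval (angles `\` circle @^-1` A)%classic).
Proof.
case=> i [p ip] ->; have iI := @interval_is_interval R i.
have tau0 := tau_gt0.
have AE x : angles x ->
    (circle @` [set` i])%classic (circle x) <-> exists k : int, x + tau *~ k \in i.
  move=> Dx; split=> [[s si Es]|[k ki]]; last first.
    by exists (x + tau *~ k) => //; rewrite circle_pointDz.
  have [k Dk] := circle_point_angle s; exists (- k).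
  suff <- : s + tau *~ k = x by rewrite mulrNz addrK.
  by apply: circle_point_inj; rewrite ?inE // circle_pointDz.
have D0 : angles 0 by rewrite /angles /= lexx.
have Dmid x y z : angles x -> angles z -> x <= y <= z -> angles y.
  rewrite /angles /=; lra.
have step (k l : int) : k < l -> tau *~ k + tau <= tau *~ l.
  move=> kl; rewrite -[X in _ + X]mulr1z -mulrzDr ler_pMz2l //; lia.
split.
  have [k Dk] := circle_point_angle p.
  exists (p + tau *~ k); split => //; apply/AE => //.
  by exists (- k); rewrite mulrNz addrK.
case: (pselect (exists k : int, tau *~ k \in i)) => [[j ji]|no]; last first.
  left=> x z [Dx /(AE _ Dx) [k ki]] [Dz /(AE _ Dz) [l li]] y xyz.
  have Dy := Dmid _ _ _ Dx Dz xyz; split=> //; apply/AE => //.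
  (* If the two translates had different indices, a multiple of [tau] would lie between them, hence
     in [i]. *)
  suff kl : k = l.
    exists k; rewrite -kl in li; apply: (iI _ _ ki li); by rewrite !lerD2r.
  move: Dx Dz xyz; rewrite /angles /= => Dx Dz xyz.
  case: (ltgtP k l) => // kl; case: no.
    exists l; apply: (iI _ _ ki li); have := step _ _ kl; lra.
  exists k; apply: (iI _ _ li ki); have := step _ _ kl; lra.
right; split; first by apply/AE => //; exists j; rewrite add0r.
move=> x z [Dx nx] [Dz nz] y xyz; have Dy := Dmid _ _ _ Dx Dz xyz.
split=> // /(AE _ Dy) [k ki].
move: (Dx) (Dz); rewrite /angles /= => Dx' Dz'.
(* The part of [i] between j tau and y + k tau contains x + k tau if j <= k, and z + k tau if k < j;
   either way an uncovered angle would be covered. *)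
case: (leP j k) => jk.
  case: nx; apply/AE => //; exists k; apply: (iI _ _ ji ki).
  have : tau *~ j <= tau *~ k by rewrite ler_pMz2l.
  lra.
case: nz; apply/AE => //; exists k; apply: (iI _ _ ki ji).
have := step _ _ jk; lra.
Qed.

End Circle.

(** * Convex and co-convex sets of reals through up-sets and down-sets *)

Section Intervals.
Variable R : realType.
Implicit Types (c : bool) (B U V : set R) (x y : R).
Local Open Scope classical_set_scope.

(* [c] says that it is the complement of [B], not [B] itself, that is convex. *)
Definition right_part c B : set R :=
  if c then [set x | forall y, ~ B y -> y < x]
  else [set x | exists2 y, B y & y <= x].

Definition left_part c B : set R :=
  if c then [set x | forall y, ~ B y -> x < y]
  else [set x | exists2 y, B y & x <= y].

Lemma right_part_up c B x y : x <= y -> right_part c B x -> right_part c B y.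
Proof.
move=> xy; case: c => /= [H z /H /lt_le_trans|[z Bz zx]]; first exact.
by exists z => //; apply: le_trans xy.
Qed.

Lemma left_part_down c B x y : x <= y -> left_part c B y -> left_part c B x.
Proof.
move=> xy; case: c => /= [H z /H|[z Bz yz]]; first exact: le_lt_trans.
by exists z => //; apply: le_trans yz.
Qed.

Lemma right_part_nested c B c' B' :
  right_part c B `<=` right_part c' B' \/ right_part c' B' `<=` right_part c B.
Proof.
case: (pselect (right_part c B `<=` right_part c' B')); first by left.
move=> /existsNP [x /not_implyP [Ux nx]]; right=> y Uy.
apply: right_part_up Ux; rewrite leNgt; apply/negP => /ltW yx.
exact: nx (right_part_up yx Uy).
Qed.

Lemma left_part_nested c B c' B' :
  left_part c B `<=` left_part c' B' \/ left_part c' B' `<=` left_part c B.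
Proof.
case: (pselect (left_part c B `<=` left_part c' B')); first by left.
move=> /existsNP [x /not_implyP [Ux nx]]; right=> y Uy.
apply: left_part_down Ux; rewrite leNgt; apply/negP => /ltW yx.
exact: nx (left_part_down yx Uy).
Qed.

Lemma partsE c B : is_interval (if c then ~` B else B) ->
  B = if c then right_part c B `|` left_part c B
      else right_part c B `&` left_part c B.
Proof.
case: c => /= I; apply/seteqP; split=> x /=.
- move=> Bx; apply: contrapT => /not_orP [/existsNP [y /not_implyP [By yx]]].
  move=> /existsNP [z /not_implyP [Bz zx]].
  apply: (I _ _ Bz By x) => //; rewrite !leNgt; apply/andP.
  by split; apply/negP.
- by case=> H; apply: contrapT => /H; rewrite ltxx.
- by move=> Bx; split; exists x.
- by move=> [[y By yx] [z Bz xz]]; apply: (I _ _ By Bz); rewrite yx.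
Qed.

(** If both sets are convex, nestedness reduces the fourfold intersection to one up-set and one
    down-set: their meet is [B], [B'], or a set from [P] or [Q]. In the mixed case, take a point in
    [P] or [Q]: either it already lies in both sets, or the nesting places every point of the convex
    set in the co-convex one. *)
Lemma meet_parts c B c' B' :
  is_interval (if c then ~` B else B) -> is_interval (if c' then ~` B' else B') ->
  B !=set0 -> B' !=set0 -> (c -> c' -> B `&` B' !=set0) ->
  (B `&` B' !=set0) <->
  let P := right_part c B `&` left_part c' B' !=set0 in
  let Q := right_part c' B' `&` left_part c B !=set0 in
  if c && c' then True else if c || c' then P \/ Q else P /\ Q.
Proof.
move=> /partsE EB /partsE EB'; rewrite {1 2 3}EB {1 2 3}EB'.
have := right_part_nested c B c' B'; have := left_part_nested c B c' B'.
move: (right_part c B) (left_part c B) => U V {EB}.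
move: (right_part c' B') (left_part c' B') => U' V' {EB'}.
case: c; case: c' => /= NV NU n n' H.
- by split=> // _; apply: H.
- case: n' => p [pU pV]; split=> [[x [[] xx [yU yV]]]|]; [by left; exists x|by right; exists x|].
  case=> [] [x [xU xV]].
    by case: NU => S; [exists x; do ?split=> //; [left|exact: S]|exists p; do ?split=> //; left; exact: S].
  by case: NV => S; [exists x; do ?split=> //; [right|exact: S]|exists p; do ?split=> //; right; exact: S].
- case: n => p [pU pV]; split=> [[x [[yU yV] []]]|].
  + by right; exists x.
  + by left; exists x.
  case=> [] [x [xU xV]].
    by case: NV => S; [exists p; do ?split=> //; right; exact: S|exists x; do ?split=> //; [exact: S|right]].
  by case: NU => S; [exists p; do ?split=> //; left; exact: S|exists x; do ?split=> //; [exact: S|left]].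
case: n n' => p [pU pV] [q [qU qV]]; split=> [[x [[? ?] [? ?]]]|[[x [? ?]] [y [? ?]]]].
  by split; exists x.
case: NU NV => SU [] SV.
- by exists p; do ?split=> //; [exact: SU|exact: SV].
- by exists x; do ?split=> //; [exact: SV|exact: SU].
- by exists y; do ?split=> //; [exact: SU|exact: SV].
- by exists q; do ?split=> //; [exact: SU|exact: SV].
Qed.

End Intervals.

(** * Circular-arc graphs and the final bound *)

Lemma circular_arc_sd_pair (R : realType) (T : finType) (e : rel T) :
  circular_arc_graph R e -> (1 < #|T| ->
  exists u v k, [/\ u != v, k ^ 2 <= #|T| & sd_pair e u v <= 16 * k])%N.
Proof.
case=> A arcA eA.
pose D : set R := [set x | 0 <= x < pi *+ 2]%classic.
pose t v := ~~ `[< is_interval (D `&` @circle_point R @^-1` A v)%classic >].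
(* Co-convex sets are extended outside [0, 2pi[ so as to be co-convex in [R]. *)
pose B v := ((@circle_point R @^-1` A v `&` D) `|` (if t v then ~` D else set0))%classic.
have tP v : t v -> A v (circle_point 0) /\
    is_interval (D `\` @circle_point R @^-1` A v)%classic.
  by move=> /asboolP tv; case: (arc_angles (arcA v)) => _ [].
have D0 : D 0 by rewrite /D /= lexx tau_gt0.
have I v : is_interval (if t v then ~` B v else B v)%classic.
  rewrite /B; case: (boolP (t v)) => [/tP [_]|].
    congr is_interval; apply/seteqP; split=> x /=.
      by move=> [Dx nx] [[]|].
    by move=> /not_orP [H /contrapT Dx]; split=> // Ax; apply: H.
  by rewrite negbK => /asboolP; rewrite setU0 setIC.
have B0 v : (B v !=set0)%classic.
  by case: (arc_angles (arcA v)) => [[x [? ?]] _]; exists x; left.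
have Btt u v : t u -> t v -> (B u `&` B v !=set0)%classic.
  by move=> /tP [? _] /tP [? _]; exists 0; split; left.
have AB u v : (A u `&` A v !=set0 <-> B u `&` B v !=set0)%classic.
  split=> [[p [pu pv]]|[x [Bu Bv]]].
    case: (arcA u) (pu) => i _ Au; rewrite Au => -[s _ sp].
    have [k Dk] := circle_point_angle s.
    exists (s + pi *+ 2 *~ k).
    by split; left; split=> //=; rewrite circle_pointDz sp.
  (* Two co-convex sets share angle 0. Otherwise one of the sets lies inside [D], so the common
     point x is a genuine angle of both arcs. *)
  case: (boolP (t u && t v)) => [/andP [/tP [? _] /tP [? _]]|].
    by exists (circle_point 0).
  move: Bu Bv; rewrite /B; case: (t u); case: (t v) => //=.
  - by move=> [[? ?]|?] [[? ?]|//]; exists (circle_point x).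
  - by move=> [[? ?]|//] [[? ?]|?]; exists (circle_point x).
  - by move=> [[? ?]|//] [[? ?]|//]; exists (circle_point x).
pose a u v := `[< right_part (t u) (B u) `&` left_part (t v) (B v) !=set0 >]%classic.
have eE w u : w != u -> e w u =
    if t w && t u then true else if t w || t u then a w u || a u w else a w u && a u w.
  move=> wu; have /= M := meet_parts (I w) (I u) (B0 w) (B0 u) (@Btt w u).
  apply/idP/idP => [/(eA _ _ wu) /AB /M|].
    case: ifP => // _; case: ifP => _; rewrite /a.
      by case=> /asboolP ->; rewrite ?orbT.
    by move=> [/asboolP -> /asboolP ->].
  move=> H; apply/(eA _ _ wu)/AB/M; move: H; case: ifP => // _; case: ifP => _.
    by case/orP => /asboolP; [left|right].
  by case/andP => /asboolP ? /asboolP ?.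
(* Row u of [a] grows with the up-set of u and column u with its down-set, so both inherit
   nestedness. *)
apply: (@sd_pair_sqrt _ e a t).
- by move=> u v w tuv wu wv E1 E2; rewrite !eE // tuv E1 E2.
- move=> u v.
  by case: (right_part_nested (t u) (B u) (t v) (B v)) => S; [left|right] => w;
    rewrite /in_mem /a /= => /asboolP [x [? ?]]; apply/asboolP; exists x;
    split=> //; exact: S.
- move=> u v.
  by case: (left_part_nested (t u) (B u) (t v) (B v)) => S; [left|right] => w;
    rewrite /in_mem /a /= => /asboolP [x [? ?]]; apply/asboolP; exists x;
    split=> //; exact: S.
Qed.

Lemma circular_arc_graph_induced (R : realType) (T : finType) (e : rel T)
    (S : {set T}) :
  circular_arc_graph R e -> circular_arc_graph R (induced e S).
Proof.
case=> A arcA eA; exists (fun v => A (val v)) => [v|u v uv]; first exact: arcA.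
by apply: eA; rewrite (inj_eq val_inj).
Qed.

Theorem theorem4 (R : realType) :
  exists2 C : R, 0 < C &
    forall (T : finType) (e : rel T),
      symmetric e -> irreflexive e -> circular_arc_graph R e ->
      (sd e)%:R <= C * Num.sqrt (#|T|%:R).
Proof.
exists 16; first by [].
move=> T e _ _ arcs.
have [k kT sdk] : exists2 k, (k ^ 2 <= #|T|)%N & (sd e <= 16 * k)%N.
  have [k /andP [k1 k2]] := nat_sqrt_bounds #|T|; exists k => //.
  apply/bigmax_leqP => S S1.
  have cS : #|{: {x : T | x \in S}}| = #|S| by rewrite card_sig; apply: eq_card.
  have [|u [v [l [uv lS sdl]]]] :=
    circular_arc_sd_pair (circular_arc_graph_induced S arcs); first by rewrite cS.
  (* The root bound l of the subgraph is at most that of the whole graph: l^2 <= #|S| <= #|T| <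
     (k+1)^2. *)
  have lk : (l <= k)%N.
    rewrite -ltnS -(@ltn_exp2r _ _ 2) //; apply: leq_ltn_trans k2.
    by apply: leq_trans (max_card S); rewrite -cS.
  apply: (@leq_trans (16 * l)); last by rewrite leq_mul2l.
  apply: leq_trans sdl.
  exact: (@bigmin_le_cond _ nat _ _ (u, v) (fun p => p.1 != p.2)).
apply: (@le_trans _ _ (16 * k%:R)); first by rewrite -natrM ler_nat.
rewrite ler_pM2l // -[k%:R]ger0_norm // -sqrtr_sqr ler_wsqrtr // -natrX ler_nat.
exact: kT.
Qed.
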